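(* If $\{S(t): t\ge 0\}$ is a semigroup on a nonempty subset $V$ of a normed space $(X,\|\cdot\|_X)$ over $\mathbb{K}\in\{\mathbb{R},\mathbb{C}\}$ satisfying the generalized squeezing property on a subset $B$ of $V$ at time $T>0$ with parameters $(n,\eta,\mu,\kappa)$ (with associated map $P:V\to X_n$), then it is quasi-stable on $B$ at time $T$ with parameters $(\eta,\kappa\mu)$ with respect to the norm $\|\cdot\|_{X_n}$ on $X_n$. Moreover, if $B$ is a nonempty bounded subset of $V$ such that $S(T)B\subseteq B$ and $\sigma\in(0,1-\eta)$, then there exist $k_0\in\mathbb{N}$, $a,b>0$ and $h\ge1$ such that the covering condition $$N^{V}(S(kT)B,aq^{k})\le b h^{k},\quad k\in\mathbb{N},\ k\ge k_0,$$ holds with $q=\eta+\sigma$ and $$h\le\Bigl(1+\tfrac{4\kappa\mu\, d_{BM}(X_n,\ell^n_2)}{\sigma}\Bigr)^{\mathbf{n}},\qquad\text{where } \mathbf{n}=\begin{cases}n&\text{if }\mathbb{K}=\mathbb{R},\\2n&\text{if }\mathbb{K}=\mathbb{C}.\end{cases}$$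
   Context: $\mathbb{N}=\{1,2,\dots\}$. $V$ carries the metric $d(x,y)=\|x-y\|_X$. A semigroup $\{S(t):t\ge0\}$ on $V$ is a family of (not necessarily linear) maps $S(t):V\to V$ with $S(t)S(s)=S(t+s)$ for $t,s\ge 0$ and $S(0)=I$; ''$t\ge 0$'' means throughout either $t\in[0,\infty)$ or $t\in\mathbb{N}\cup\{0\}$ (and $T$ belongs to the time set). Generalized squeezing property on $B\subseteq V$ at time $T>0$ with parameters $(n,\eta,\mu,\kappa)$: there exist a map $P:V\to X_n$ (possibly nonlinear) with values in a normed space $(X_n,\|\cdot\|_{X_n})$ over $\mathbb{K}$ of dimension $n\in\mathbb{N}$ and constants $\eta\in[0,1)$, $\mu>0$, $\kappa>0$ such that for all $x,y\in B$ $$\|S(T)x-S(T)y\|_X\le\eta\|x-y\|_X+\mu\|PS(T)x-PS(T)y\|_{X_n},\qquad \|PS(T)x-PS(T)y\|_{X_n}\le\kappa\|x-y\|_X.$$ A compact seminorm on a normed space $Z$ is a seminorm $\mathfrak{n}_Z$ such that any bounded sequence $z_k\in Z$ has a subsequence $z_{k_j}$ with $\mathfrak{n}_Z(z_{k_j}-z_{k_l})\to0$ as $j,l\to\infty$. The semigroup is quasi-stable on $B$ at time $T$ with respect to a compact seminorm $\mathfrak{n}_Z$ on a normed space $Z$ and parameters $(\eta',\kappa')$ ($\eta'\in[0,1)$, $\kappa'>0$) if there is a map $K:B\to Z$ such that for all $x,y\in B$: $\|Kx-Ky\|_Z\le\kappa' d(x,y)$ and $d(S(T)x,S(T)y)\le\eta'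 d(x,y)+\mathfrak{n}_Z(Kx-Ky)$. (Here $Z=X_n$ and $\mathfrak{n}_Z=\|\cdot\|_{X_n}$.) $\ell_2^n$ is $\mathbb{K}^n$ with the Euclidean norm, and the multiplicative Banach–Mazur distance is $d_{BM}(X_n,\ell^n_2)=\inf\{\|\Lambda\|_{\mathcal{L}(X_n,\ell^n_2)}\|\Lambda^{-1}\|_{\mathcal{L}(\ell^n_2,X_n)}:\Lambda:X_n\to\ell^n_2\text{ a linear isomorphism}\}$. $N^V(G,\varepsilon)$ is the minimal number of open $\varepsilon$-balls in $V$ centered at points of $G$ needed to cover $G$. *)

(* Defs.v *)
From HB Require Import structures.
From mathcomp Require Import all_boot all_order all_algebra.
From mathcomp Require Import complex.
From mathcomp Require Import all_classical all_reals all_analysis.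

Set Implicit Arguments.
Unset Strict Implicit.
Unset Printing Implicit Defensive.

Import Order.TTheory GRing.Theory Num.Theory.
Import numFieldNormedType.Exports.

Local Open Scope classical_set_scope.
Local Open Scope ring_scope.

Inductive scalar_kind : Set := RealScalars | ComplexScalars.

Definition scalar_field (R : realType) (s : scalar_kind) : numFieldType :=
  match s with
  | RealScalars => R : numFieldType
  | ComplexScalars => R[i] : numFieldType
  end.

Definition real_part (R : realType) (s : scalar_kind) :
    scalar_field R s -> R :=
  match s return scalar_field R s -> R with
  | RealScalars => fun x => x
  | ComplexScalars => fun z => complex.Re z
  end.

(* The dimension over the reals of an n-dimensional space over the scalars. *)
Definition real_dim (s : scalar_kind) (n : nat) : nat :=
  match s with RealScalars => n | ComplexScalars => (2 * n)%N end.

(* In a normedModType K the norm takes its values in K; for complex scalars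
   these values have zero imaginary part, so [rnorm] is the same norm seen as
   a real number. *)
Definition rnorm (R : realType) (s : scalar_kind)
    (X : normedModType (scalar_field R s)) (x : X) : R := real_part `|x|.

Definition has_dimension (K : numFieldType) (X : lmodType K) (n : nat) : Prop :=
  exists e : 'I_n -> X,
    forall x : X, exists! c : 'rV[K]_n, x = \sum_(i < n) c ord0 i *: e i.

(* The library norm on 'rV[K]_n is the sup norm, whence this definition. *)
Definition l2norm (R : realType) (s : scalar_kind) (n : nat)
    (v : 'rV[scalar_field R s]_n) : R :=
  Num.sqrt (\sum_(i < n) (real_part `|v ord0 i|) ^+ 2).

(* The real-valued [sup] is the intended one only if f is bounded; this is
   automatic for linear maps between finite-dimensional normed spaces, the only
   case in which [opnorm] is used below. *)
Definition opnorm (R : realType) (U W : Type) (normU : U -> R) (normW : W -> R)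
    (f : U -> W) : R :=
  sup [set normW (f u) | u in [set u | normU u <= 1]].

Definition banach_mazur_l2 (R : realType) (s : scalar_kind)
    (Y : normedModType (scalar_field R s)) (n : nat) : R :=
  inf [set r : R |
    exists (L : {linear Y -> 'rV[scalar_field R s]_n})
           (M : {linear 'rV[scalar_field R s]_n -> Y}),
      [/\ cancel L M, cancel M L &
          r = opnorm (@rnorm R s Y) (@l2norm R s n) L *
              opnorm (@l2norm R s n) (@rnorm R s Y) M]].

Inductive time_kind : Set := ContinuousTime | DiscreteTime.

Definition time_set (R : realType) (tau : time_kind) : set R :=
  match tau with
  | ContinuousTime => [set t | 0 <= t]
  | DiscreteTime => range (fun k : nat => k%:R)
  end.

(* The values of S outside the time set are irrelevant. *)
Definition is_semigroup (R : realType) (tau : time_kind) (V : Type)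
    (S : R -> V -> V) : Prop :=
  (forall x, S 0 x = x) /\
  (forall t r x, time_set tau t -> time_set tau r ->
     S t (S r x) = S (t + r) x).

Section SubsetOfNormedSpace.
Context {R : realType} {s : scalar_kind}.
Context {X : normedModType (scalar_field R s)} {V : set X}.

Definition vdist (x y : V) : R := rnorm (\val x - \val y).

Definition generalized_squeezing (S : R -> V -> V) (B : set V) (T : R) (n : nat)
    (Xn : normedModType (scalar_field R s)) (P : V -> Xn)
    (eta mu kappa : R) : Prop :=
  [/\ (0 < n)%N /\ has_dimension Xn n,
      0 <= eta < 1, 0 < mu, 0 < kappa &
      forall x y, B x -> B y ->
        vdist (S T x) (S T y) <=
          eta * vdist x y + mu * rnorm (P (S T x) - P (S T y)) /\
        rnorm (P (S T x) - P (S T y)) <= kappa * vdist x y].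

Definition is_seminorm (Z : normedModType (scalar_field R s)) (p : Z -> R) :
    Prop :=
  [/\ forall z, 0 <= p z,
      forall z w, p (z + w) <= p z + p w &
      forall (c : scalar_field R s) z, p (c *: z) = real_part `|c| * p z].

Definition compact_seminorm (Z : normedModType (scalar_field R s))
    (p : Z -> R) : Prop :=
  is_seminorm p /\
  forall z : nat -> Z, bounded_set (range z) ->
    exists phi : nat -> nat,
      {homo phi : i j / (i < j)%N} /\
      p (z (phi jl.1) - z (phi jl.2)) @[jl --> (\oo, \oo)] --> (0 : R).

Definition quasi_stable (S : R -> V -> V) (B : set V) (T : R)
    (Z : normedModType (scalar_field R s)) (p : Z -> R) (eta kappa : R) : Prop :=
  [/\ compact_seminorm p, 0 <= eta < 1, 0 < kappa &
      exists K : B -> Z, forall x y : B,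
        rnorm (K x - K y) <= kappa * vdist (\val x) (\val y) /\
        vdist (S T (\val x)) (S T (\val y)) <=
          eta * vdist (\val x) (\val y) + p (K x - K y)].

(* Extended-real valued: +oo if no finite cover exists. *)
Definition covering_number (G : set V) (eps : R) : \bar R :=
  ereal_inf [set (m%:R)%:E | m in [set m : nat |
    exists c : 'I_m -> V, (forall i, G (c i)) /\
      G `<=` \bigcup_i [set y | vdist (c i) y < eps]]].

End SubsetOfNormedSpace.

(* Main.v *)
(* The map K = mu P S(T) gives quasi-stability at once, the norm of a
   finite-dimensional space being a compact seminorm.  For the covering
   condition, cover S(kT)B by at most h^k sets of diameter at most d q^k (sets
   rather than balls, so that no factor is lost on the term eta ||x - y||).
   The image under P S(T) of such a piece has diameter at most kappa d q^k;
   split the piece according to a maximal (sigma d q^k / 2 mu)-separated set in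
   this image.  A packing bound gives at most h = (1 + 4 kappa mu / sigma)^N
   parts, N being the real dimension, and the image of each part under S(T) has
   diameter at most d q^(k+1).  This works in the norm of X_n itself, so the
   Banach-Mazur distance enters only through d_BM >= 1. *)

Require Import Defs.
From HB Require Import structures.
From mathcomp Require Import all_boot all_order all_algebra.
From mathcomp Require Import complex.
From mathcomp Require Import all_classical all_reals all_analysis.
From mathcomp Require Import ring lra.
Import Order.TTheory GRing.Theory Num.Theory.
Import numFieldNormedType.Exports.
Local Open Scope classical_set_scope.
Local Open Scope ring_scope.

Set Implicit Arguments.
Unset Strict Implicit.
Unset Printing Implicit Defensive.

(** * Packing numbers of seminorms on R^N *)

Lemma bernoulli_ineq (R : realType) (t : R) (k : nat) :
  0 <= t -> 1 + k%:R * t <= (1 + t) ^+ k.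
Proof.
move=> t0; elim: k => [|k IH]; first by rewrite mul0r addr0 expr0.
rewrite exprS; apply: (le_trans _ (ler_wpM2l _ IH)); last by rewrite addr_ge0.
have := mulr_ge0 (ler0n R k) (mulr_ge0 t0 t0).
rewrite -[k.+1]addn1 natrD; nra.
Qed.

(** If [z < y], Bernoulli's inequality makes [(y / z) ^+ k] outgrow [D]. This removes the constant
    factor left by the count in [packing_bound]. *)
Lemma le_of_exp_growth (R : realType) (y z D : R) :
  0 < z -> (forall k, y ^+ k <= D * z ^+ k) -> y <= z.
Proof.
move=> z0 H; rewrite leNgt; apply/negP => zy.
pose t := y / z - 1.
have t0 : 0 < t by rewrite subr_gt0 ltr_pdivlMr // mul1r.
have bnd k : 1 + k%:R * t <= D.
  apply: (le_trans (bernoulli_ineq _ (ltW t0))).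
  rewrite /t addrCA subrr addr0 expr_div_n ler_pdivrMr ?exprn_gt0 //.
have D0 : 0 <= D by have := bnd 0%N; rewrite mul0r; lra.
have := archi_boundP (divr_ge0 D0 (ltW t0)).
rewrite ltr_pdivrMr // => h; have := bnd (Num.bound (D / t)); lra.
Qed.

Definition seminorm_rV (R : realType) N (p : 'rV[R]_N -> R) : Prop :=
  (forall u v, p (u + v) <= p u + p v) /\
  (forall t u, p (t *: u) = `|t| * p u).

Section Seminorm.
Context {R : realType} {N : nat} {p : 'rV[R]_N -> R}.
Hypothesis sp : seminorm_rV p.

Lemma seminorm0 : p 0 = 0.
Proof. by rewrite -(scale0r (0 : 'rV[R]_N)) sp.2 normr0 mul0r. Qed.

Lemma seminormN u : p (- u) = p u.
Proof. by rewrite -scaleN1r sp.2 normrN normr1 mul1r. Qed.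

Lemma seminormB u v : p (u - v) = p (v - u).
Proof. by rewrite -seminormN opprB. Qed.

Lemma seminorm_ge0 u : 0 <= p u.
Proof.
have := sp.1 u (- u); rewrite subrr seminorm0 seminormN; lra.
Qed.

Lemma seminorm_leB u v : p (u - v) <= p u + p v.
Proof. by rewrite -[p v]seminormN; exact: sp.1. Qed.

(** Expansion in the standard basis; the extra 1 in the constant keeps it positive even if [p]
    vanishes on the basis. *)
Lemma seminorm_coord : exists2 C, 0 < C &
  forall (A : R) (u : 'rV[R]_N), 0 <= A ->
    (forall i, `|u ord0 i| <= A) -> p u <= C * A.
Proof.
exists (1 + \sum_(i < N) p (delta_mx ord0 i)) => [|A u A0 uA].
  by rewrite ltr_pwDl // sumr_ge0 // => i _; exact: seminorm_ge0.
have sum_le (r : seq 'I_N) (f : 'I_N -> 'rV[R]_N) :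
    p (\sum_(i <- r) f i) <= \sum_(i <- r) p (f i).
  elim: r => [|i r IH]; first by rewrite !big_nil seminorm0.
  by rewrite !big_cons (le_trans (sp.1 _ _)) // lerD2l.
rewrite [u in p u]row_sum_delta (le_trans (sum_le _ _)) //.
rewrite mulrDl mul1r mulr_suml (@le_trans _ _
  (\sum_(i < N) p (delta_mx ord0 i) * A)) ?lerDr //.
by apply: ler_sum => i _; rewrite sp.2 mulrC ler_wpM2l ?seminorm_ge0.
Qed.

(** * Self-similar point sets *)

Section Fractal.
Variables (M : nat) (x : 'I_M -> 'rV[R]_N) (theta : R).

(** For [w = i_1 ... i_k] this is the sum of [theta ^+ (j - 1) *: x i_j], the image of 0 under a
    composition of the contractions [u => x i + theta *: u]. *)
Definition fractal_point (w : seq 'I_M) : 'rV[R]_N :=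
  foldr (fun i u => x i + theta *: u) 0 w.

(** The hypothesis makes every contraction map the [p]-ball of radius [rho] about 0 into itself. *)
Lemma fractal_point_le rho : 0 <= theta -> 0 <= rho ->
  (forall i, p (x i) + theta * rho <= rho) ->
  forall w, p (fractal_point w) <= rho.
Proof.
move=> theta0 rho0 xrho; elim=> [|i w IH] /=; first by rewrite seminorm0.
rewrite (le_trans (sp.1 _ _)) // sp.2 ger0_norm // (le_trans _ (xrho i)) //.
by rewrite lerD2l ler_wpM2l.
Qed.

(** Each letter of a common prefix costs a factor [theta]. Once the first letters [i] and [j]
    differ, the scaled tails have seminorm at most [theta * rho] each and cannot close the gap
    between [x i] and [x j]. *)
Lemma fractal_point_sep rho : 0 < theta <= 1 -> 0 <= rho ->
  (forall i, p (x i) + theta * rho <= rho) ->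
  (forall i j, i != j -> 2 * (theta * rho) < p (x i - x j)) ->
  exists2 delta, 0 < delta & forall k w v,
    size w = k -> size v = k -> w != v ->
    delta * theta ^+ k <= p (fractal_point w - fractal_point v).
Proof.
move=> /andP[theta_gt0 theta_le1] rho0 xrho xsep.
(* The least excess over all pairs; the start value 1 covers the case of no distinct pair. *)
pose delta := \big[Num.min/1]_(ij : 'I_M * 'I_M | ij.1 != ij.2)
  (p (x ij.1 - x ij.2) - 2 * (theta * rho)).
have delta0 : 0 < delta.
  by apply: lt_bigmin => // -[i j] /= ij; rewrite subr_gt0 xsep.
have deltale i j : i != j -> 2 * (theta * rho) + delta <= p (x i - x j).
  move=> ij; rewrite -lerBrDl.
  exact: (@bigmin_le_cond _ R _ 1 (i, j) (fun ij => ij.1 != ij.2)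
    (fun ij => p (x ij.1 - x ij.2) - 2 * (theta * rho))).
exists delta => // k; elim: k => [|k IH] [|i w] [|j v] //= [sw] [sv].
have [->|ij _] := eqVneq i j.
  rewrite eqseq_cons eqxx /= => /(IH _ _ sw sv) h.
  rewrite opprD addrACA subrr add0r -scalerBr sp.2 gtr0_norm // exprS mulrCA.
  by rewrite ler_pM2l.
rewrite opprD addrACA -scalerBr.
have := seminorm_leB (x i - x j + theta *: (fractal_point w - fractal_point v))
  (theta *: (fractal_point w - fractal_point v)).
rewrite addrK sp.2 gtr0_norm //.
have := ler_wpM2l (ltW theta_gt0)
  (seminorm_leB (fractal_point w) (fractal_point v)).
have := ler_wpM2l (ltW theta_gt0)
  (fractal_point_le (ltW theta_gt0) rho0 xrho w).
have := ler_wpM2l (ltW theta_gt0)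
  (fractal_point_le (ltW theta_gt0) rho0 xrho v).
have : delta * theta ^+ k.+1 <= delta.
  by rewrite ger_pMr // exprn_ile1 // ltW.
rewrite mulrDr; have := deltale i j ij; lra.
Qed.

(** A geometric series bounds the coordinates uniformly in the length of the word. A bound on [p]
    would not do, since [p] may vanish off 0. *)
Lemma fractal_point_coord : 0 <= theta < 1 ->
  exists2 A, 0 <= A & forall w j, `|fractal_point w ord0 j| <= A.
Proof.
move=> /andP[theta_ge0 theta_lt1].
pose A := \sum_(i < M) \sum_(j < N) `|x i ord0 j|.
have A0 : 0 <= A by apply: sumr_ge0 => i _; apply: sumr_ge0.
have xA i j : `|x i ord0 j| <= A.
  rewrite /A (bigD1 i) //= (bigD1 j) //= -addrA lerDl addr_ge0 // sumr_ge0 //.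
  by move=> k _; apply: sumr_ge0.
have t1 : 0 < 1 - theta by rewrite subr_gt0.
exists (A / (1 - theta)); first by rewrite divr_ge0 // ltW.
elim=> [|i w IH] j /=; first by rewrite mxE normr0 divr_ge0 // ltW.
rewrite !mxE (le_trans (ler_normD _ _)) // normrM (ger0_norm theta_ge0).
have -> : A / (1 - theta) = A + theta * (A / (1 - theta)).
  by field; rewrite gt_eqF.
by rewrite lerD // ler_wpM2l.
Qed.

End Fractal.

(* With theta = (1 + 2 r / e)^-1 the pieces x_i + theta K of the self-similar
   set K generated by the x_i stay a positive distance apart.  Its M^k points
   of level k are thus theta^k-separated up to a constant, and a grid of mesh
   theta^k has only O(theta^(- k N)) cells. *)
Lemma packing_bound (M : nat) (x : 'I_M -> 'rV[R]_N) (r e : R) :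
  0 < r -> 0 < e -> (forall i, p (x i) <= r) ->
  (forall i j, i != j -> e < p (x i - x j)) ->
  M%:R <= (1 + 2 * r / e) ^+ N.
Proof.
move=> r0 e0 xr xe.
have re0 : 0 < 2 * r + e by lra.
(* [rho] solves [r + theta * rho = rho], and [2 * (theta * rho) = e], so the bounds by [r] and [e]
   are exactly what [fractal_point_sep] asks. *)
pose theta := e / (2 * r + e); pose rho := r + e / 2.
have theta0 : 0 < theta by rewrite divr_gt0.
have theta1 : theta < 1 by rewrite ltr_pdivrMr // mul1r; lra.
have theta_rho : theta * rho = e / 2.
  by rewrite /theta /rho; field; rewrite gt_eqF.
have rho0 : 0 <= rho by rewrite /rho; lra.
have xrho i : p (x i) + theta * rho <= rho by rewrite theta_rho lerD2r.
have [C C0 pC] := seminorm_coord.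
have [|i j ij|delta delta0 sep] := fractal_point_sep _ rho0 xrho.
- by rewrite theta0 ltW.
- by rewrite theta_rho mulrC divfK // xe.
have [|A A0 ptA] := @fractal_point_coord _ x theta.
  by rewrite theta1 ltW.
pose pt := fractal_point x theta.
have -> : 1 + 2 * r / e = theta^-1.
  by rewrite /theta; field; rewrite !gt_eqF.
pose D := 4 * A * C / delta + 1.
have D0 : 0 <= 4 * A * C / delta by rewrite divr_ge0 ?mulr_ge0 // ltW.
apply: (@le_of_exp_growth _ _ _ (D ^+ N)) => [|k].
  by rewrite exprn_gt0 // invr_gt0.
(* With this mesh, points in one cell are at [p]-distance at most [C * g], half the separation of
   level [k]; so [cell] is injective. *)
pose g := delta * theta ^+ k / (2 * C).
have tk0 : 0 < theta ^+ k by rewrite exprn_gt0.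
have g0 : 0 < g by rewrite divr_gt0 ?mulr_gt0.
(* Enough cells of side [g] for the coordinate range from [- A] to [A]. *)
pose m := (Num.truncn (2 * A / g)).+1.
have q0 w j : 0 <= (pt w ord0 j + A) / g.
  rewrite divr_ge0 ?(ltW g0) //; have := ptA w j; rewrite ler_norml; lra.
have cell_lt w j :
    (Num.truncn ((pt w ord0 j + A) / g) < m)%N.
  rewrite ltnS le_truncn // ler_pM2r ?invr_gt0 //.
  by have := ptA w j; rewrite ler_norml; lra.
pose cell (w : k.-tuple 'I_M) : {ffun 'I_N -> 'I_m} :=
  [ffun j => Ordinal (cell_lt w j)].
have cell_inj : injective cell.
  move=> w v /ffunP wv; apply/eqP/negPn/negP => wNv.
  have := sep k w v (size_tuple w) (size_tuple v) wNv.
  apply/negP; rewrite -ltNge.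
  apply: (@le_lt_trans _ _ (C * g)).
    apply: pC => [|j]; first exact: ltW.
    have /(congr1 val) /= := wv j; rewrite !ffunE /= => tt.
    have /andP[a1 a2] := truncn_itv (q0 w j).
    have /andP[b1 b2] := truncn_itv (q0 v j).
    rewrite -tt -natr1 in b1 b2; rewrite -natr1 in a2.
    rewrite !mxE.
    have -> : pt w ord0 j - pt v ord0 j =
        ((pt w ord0 j + A) / g -
         (pt v ord0 j + A) / g) * g.
      by field; rewrite gt_eqF.
    rewrite normrM (gtr0_norm g0) ger_pMl // ler_norml.
    by apply/andP; split; lra.
  have -> : C * g = delta * theta ^+ k / 2.
    by rewrite /g; field; rewrite gt_eqF.
  have := mulr_gt0 delta0 tk0; lra.
(* This gives [M ^ k <= m ^ N], where [m] is at most [D * theta^-1 ^+ k]. *)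
have := leq_card cell cell_inj.
rewrite card_tuple card_ffun !card_ord => /(@ler_wpMn2l R 1 ler01).
rewrite !natrX => /le_trans; apply.
rewrite exprAC -exprMn lerXn2r ?nnegrE //.
  by rewrite mulr_ge0 ?exprn_ge0 ?invr_ge0 ?addr_ge0 // ltW.
rewrite -natr1 (@le_trans _ _ (2 * A / g + 1)) //.
  by rewrite lerD2r truncn_le (divr_ge0 _ (ltW g0)) // mulr_ge0.
have -> : 2 * A / g = 4 * A * C / delta * theta^-1 ^+ k.
  by rewrite /g exprVn; field; rewrite !gt_eqF.
by rewrite /D [leRHS]mulrDl mul1r lerD2l exprVn invf_ge1 // exprn_ile1 // ltW.
Qed.

End Seminorm.

(** * Norms on R^N *)

Lemma ler_coord_norm {R : realType} {N : nat} (u : 'rV[R]_N) (i : 'I_N) :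
  `|u ord0 i| <= `|u|.
Proof.
by rewrite [leRHS]/Num.norm /= mx_normrE; exact: (le_bigmax _ _ (ord0, i)).
Qed.

Lemma near_norm_lt {R : realType} {N : nat} (u : 'rV[R]_N) (d : R) :
  0 < d -> \forall v \near u, `|u - v| < d.
Proof. by move=> d0; apply/nbhs_normP; exists d. Qed.

Lemma seminorm_continuous {R : realType} {N : nat} (p : 'rV[R]_N -> R) :
  seminorm_rV p -> continuous p.
Proof.
move=> sp u; have [C C0 pC] := seminorm_coord sp.
apply/(@cvgrPdist_lt _ _ _ (nbhs u) (nbhs_filter u)) => e e0.
apply: (filterS _ (near_norm_lt u (divr_gt0 e0 C0))) => v uv.
have puv : p (u - v) < e.
  apply: (@le_lt_trans _ _ (C * `|u - v|)).
    by apply: pC => // i; exact: ler_coord_norm.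
  by rewrite mulrC -ltr_pdivlMr.
have := sp.1 v (u - v); have := sp.1 u (v - u).
rewrite ![_ + (_ - _)]addrC !subrK (seminormB sp v u) => h1 h2.
by rewrite ltr_norml; apply/andP; split; lra.
Qed.

Lemma norm_rV_continuous {R : realType} {N : nat} :
  continuous (fun u : 'rV[R]_N => `|u|).
Proof.
by apply: seminorm_continuous; split=> *; rewrite ?ler_normD ?normrZ.
Qed.

(** [p] is continuous, so it attains a positive minimum on the compact unit sphere. The zero space,
    whose sphere is empty, is treated apart. *)
Lemma norm_lower_bound {R : realType} {N : nat} (p : 'rV[R]_N -> R) :
  seminorm_rV p -> (forall u, p u = 0 -> u = 0) ->
  exists2 c, 0 < c & forall u, `|u| <= c * p u.
Proof.
move=> sp p_def.
have [[u0 u0N0]|all0] := pselect (exists u : 'rV[R]_N, u != 0); last first.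
  exists 1 => // u; have [->|uN0] := eqVneq u 0.
    by rewrite normr0 (seminorm0 sp) mulr0.
  by exfalso; apply: all0; exists u.
pose sphere := [set u : 'rV[R]_N | `|u| = 1].
have in_sphere (u : 'rV[R]_N) : u != 0 -> sphere (`|u|^-1 *: u).
  by move=> uN0; rewrite /sphere /= normrZ normfV normr_id mulVf // normr_eq0.
have sphere_cpt : compact sphere.
  apply: bounded_closed_compact.
    by exists 1; split=> // M M1 u /= ->; exact: ltW.
  exact: ((continuous_closedP _).1 (@norm_rV_continuous R N) _
    (@closed_eq R 1)).
have [|v] := EVT_min_rV _ sphere_cpt
    (continuous_subspaceT (seminorm_continuous sp)).
  by exists (`|u0|^-1 *: u0); exact: in_sphere.
rewrite inE => v1 vmin.
have pv0 : 0 < p v.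
  rewrite lt_neqAle (seminorm_ge0 sp) andbT eq_sym; apply/eqP => /p_def v0.
  by move: v1; rewrite /sphere /= v0 normr0 => /esym/eqP; rewrite oner_eq0.
exists (p v)^-1; first by rewrite invr_gt0.
move=> u; have [->|uN0] := eqVneq u 0.
  by rewrite normr0 (seminorm0 sp) mulr0.
have := vmin _ (mem_set (in_sphere _ uN0)).
rewrite sp.2 normfV normr_id mulrC ler_pdivlMr ?normr_gt0 //.
by rewrite ler_pdivlMl.
Qed.

Lemma seminorm_dominated {R : realType} {N : nat} (p g : 'rV[R]_N -> R) :
  seminorm_rV p -> (forall u, p u = 0 -> u = 0) -> seminorm_rV g ->
  exists2 C, 0 < C & forall u, g u <= C * p u.
Proof.
move=> sp p_def sg; have [c c0 pc] := norm_lower_bound sp p_def.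
have [C C0 gC] := seminorm_coord sg.
exists (C * c) => [|u]; first exact: mulr_gt0.
rewrite -mulrA; apply: gC => [|i]; first by rewrite (le_trans _ (pc u)).
exact: le_trans (ler_coord_norm u i) (pc u).
Qed.

(** Bolzano-Weierstrass: the sequence stays in a compact ball of the sup norm, and a subsequence
    approaches a cluster point [l]. *)
Lemma bounded_cauchy_subsequence {R : realType} {N : nat} (p : 'rV[R]_N -> R)
    (z : nat -> 'rV[R]_N) (A : R) :
  seminorm_rV p -> (forall u, p u = 0 -> u = 0) -> (forall k, p (z k) <= A) ->
  exists phi : nat -> nat, {homo phi : i j / (i < j)%N} /\
    forall e, 0 < e -> exists n0, forall j l, (n0 <= j)%N -> (n0 <= l)%N ->
      p (z (phi j) - z (phi l)) < e.
Proof.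
move=> sp p_def zA; have [c c0 pc] := norm_lower_bound sp p_def.
have [C C0 pC] := seminorm_coord sp.
pose K := [set u : 'rV[R]_N | `|u| <= c * A].
have K_cpt : compact K.
  apply: bounded_closed_compact.
    exists (c * A); split=> [|M M1 u /= uA]; first exact: num_real.
    by rewrite (le_trans uA) // ltW.
  exact: ((continuous_closedP _).1 (@norm_rV_continuous R N) _
    (@closed_le R (c * A))).
have [|l [_ zl]] := K_cpt (z @ \oo).
  by exists 0%N => // k _; rewrite /K /= (le_trans (pc _)) // ler_pM2l.
(* From [(j, n)]: an index beyond [n] whose term is within [1 / (j + 1)] of [l]. *)
have next (jn : nat * nat) :
    {m | (jn.2 < m)%N & `|l - z m| < jn.1.+1%:R^-1}.
  apply/cid2; case: jn => j n /=.
  have [||_ [[m nm <-] zm]] := zl [set z m | m in [set m | (n < m)%N]]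
    [set v | `|l - v| < j.+1%:R^-1].
  - by exists n.+1 => // m nm; exists m.
  - by apply: near_norm_lt; rewrite invr_gt0.
  - by exists m.
pose phi := fix phi j := match j with
  | 0%N => s2val (next (0, 0)%N)
  | j'.+1 => s2val (next (j'.+1, phi j'))
  end.
have phi_close j : `|l - z (phi j)| < j.+1%:R^-1.
  by case: j => [|j] /=; exact: (s2valP' (next (_, _))).
exists phi; split.
  apply: homo_ltn => [a b d ab bd|j]; first exact: ltn_trans bd.
  exact: (s2valP (next (_, _))).
move=> e e0; pose n0 := Num.bound (2 * C / e).
exists n0 => i j n0i n0j.
have close k : (n0 <= k)%N -> `|l - z (phi k)| < e / (2 * C).
  move=> nk; rewrite (lt_le_trans (phi_close k)) // invf_ple ?posrE //.
    rewrite invf_div (le_trans (ltW (archi_boundP _))) //.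
      by rewrite divr_ge0 ?mulr_ge0 // ltW.
    by rewrite ler_nat ltnW.
  by rewrite divr_gt0 ?mulr_gt0.
apply: (@le_lt_trans _ _ (C * `|z (phi i) - z (phi j)|)).
  by apply: pC => // k; exact: ler_coord_norm.
have := ler_normD (z (phi i) - l) (l - z (phi j)).
rewrite addrA subrK (distrC _ l) => tri.
rewrite mulrC -ltr_pdivlMr // (le_lt_trans tri) //.
have -> : e / C = e / (2 * C) + e / (2 * C) by field; rewrite gt_eqF.
by rewrite ltrD ?close.
Qed.

(** * Real and complex scalars *)

Section Scalars.
Context {R : realType} {s : scalar_kind}.
Local Notation K := (scalar_field R s).

Definition scalar_abs (c : K) : R := real_part `|c|.

Definition of_real : R -> K :=
  match s return R -> scalar_field R s with
  | RealScalars => fun t => t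
  | ComplexScalars => fun t => Complex t 0
  end.

Lemma scalar_abs_of_real t : scalar_abs (of_real t) = `|t|.
Proof.
rewrite /scalar_abs /of_real /real_part; case: s => //=.
rewrite -[LHS]/(complex.Re `|Complex t 0|) normc_def /=.
by rewrite expr0n addr0 sqrtr_sqr.
Qed.

Lemma real_partD (a b : K) : real_part (a + b) = real_part a + real_part b.
Proof. by move: a b; rewrite /real_part; case: s => //= -[? ?] [? ?]. Qed.

Lemma ler_real_part (a b : K) : a <= b -> real_part a <= real_part b.
Proof.
by move: a b; rewrite /real_part; case: s => //= a b; rewrite lecE => /andP[].
Qed.

Lemma real_partM (a b : K) : 0 <= a ->
  real_part (a * b) = real_part a * real_part b.
Proof.
move: a b; rewrite /real_part; case: s => //= -[a a'] [b b'].
by move=> /ger0_Im /= ->; rewrite mul0r subr0.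
Qed.

Lemma real_part0 : real_part (0 : K) = 0.
Proof. by rewrite /real_part; case: s. Qed.

Lemma real_part_eq0 (a : K) : 0 <= a -> real_part a = 0 -> a = 0.
Proof.
move: a; rewrite /real_part; case: s => //= -[a b] /ger0_Im /= -> ->.
by apply/eqP; rewrite eq_complex !eqxx.
Qed.

Section RealNorm.
Context {X : normedModType K}.
Implicit Types x y : X.

Lemma rnorm_ge0 x : 0 <= rnorm x.
Proof. by rewrite -real_part0; exact: ler_real_part. Qed.

Lemma rnormD x y : rnorm (x + y) <= rnorm x + rnorm y.
Proof.
by rewrite /rnorm -real_partD; apply: ler_real_part; exact: ler_normD.
Qed.

Lemma rnormZ (c : K) x : rnorm (c *: x) = scalar_abs c * rnorm x.
Proof. by rewrite /rnorm normrZ real_partM. Qed.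

Lemma rnorm0 : rnorm (0 : X) = 0.
Proof. by rewrite /rnorm normr0 real_part0. Qed.

Lemma rnorm_eq0 x : rnorm x = 0 -> x = 0.
Proof. by move=> /(real_part_eq0 (normr_ge0 _)) /normr0_eq0. Qed.

Lemma rnormB x y : rnorm (x - y) = rnorm (y - x).
Proof. by rewrite /rnorm distrC. Qed.

Lemma rnorm_sum (I : Type) (r : seq I) (f : I -> X) :
  rnorm (\sum_(i <- r) f i) <= \sum_(i <- r) rnorm (f i).
Proof.
elim: r => [|i r IH]; first by rewrite !big_nil rnorm0.
by rewrite !big_cons (le_trans (rnormD _ _)) // lerD2l.
Qed.

Lemma bounded_set_rnorm (A : set X) : bounded_set A ->
  exists2 M, 0 < M & forall x, A x -> rnorm x <= M.
Proof.
move=> /(@pinfty_ex_gt0 K) [M M0 AM].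
exists (1 + real_part M) => [|x /AM xM].
  by rewrite ltr_pwDl // -real_part0; exact/ler_real_part/ltW.
by rewrite (le_trans (ler_real_part xM)) // lerDr.
Qed.

End RealNorm.

Lemma scalar_absD (a b : K) : scalar_abs (a + b) <= scalar_abs a + scalar_abs b.
Proof.
by rewrite /scalar_abs -real_partD; apply: ler_real_part; exact: ler_normD.
Qed.

Lemma scalar_absM (a b : K) : scalar_abs (a * b) = scalar_abs a * scalar_abs b.
Proof. by rewrite /scalar_abs normrM real_partM. Qed.

Lemma scalar_abs_ge0 (a : K) : 0 <= scalar_abs a.
Proof. by rewrite -real_part0; exact: ler_real_part. Qed.

Lemma scalar_abs_eq0 (a : K) : scalar_abs a = 0 -> a = 0.
Proof. by move=> /(real_part_eq0 (normr_ge0 _)) /normr0_eq0. Qed.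

(* Over the complex numbers the first n real coordinates are the real parts and
   the last n the imaginary parts. *)
Lemma realification (n : nat) :
  exists F : 'rV[R]_(real_dim s n) -> 'rV[K]_n,
    [/\ forall u v, F (u + v) = F u + F v,
        forall t u, F (t *: u) = of_real t *: F u,
        forall u, F u = 0 -> u = 0 &
        forall v, exists u, F u = v].
Proof.
rewrite /of_real; case: s => /=.
  by exists id; split=> // v; exists v.
rewrite mul2n -addnn.
exists (fun u : 'rV[R]_(n + n) =>
  \row_i (Complex (lsubmx u ord0 i) (rsubmx u ord0 i) : R[i])).
split.
- by move=> u v; apply/rowP => i; rewrite !mxE.
- move=> t u; apply/rowP => i; rewrite !mxE; apply/eqP.
  by rewrite eq_complex /= !mul0r subr0 addr0 !eqxx.
- move=> u /rowP u0; rewrite -[u]hsubmxK.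
  suff [-> ->] : lsubmx u = 0 /\ rsubmx u = 0 by rewrite row_mx0.
  by split; apply/rowP => i; have := u0 i; rewrite !mxE => -[].
- move=> v; exists (row_mx (\row_i complex.Re (v ord0 i))
    (\row_i complex.Im (v ord0 i))).
  apply/rowP => i; rewrite !mxE (unsplitK (inl i)) (unsplitK (inr i)) !mxE.
  by case: (v ord0 i).
Qed.

End Scalars.

(** * Finite-dimensional normed spaces *)

(** Bundles maps whose linearity is only established in the middle of a proof. *)
Lemma linear_pack (K : numFieldType) (U W : lmodType K) (f : U -> W) :
  linear f -> exists g : {linear U -> W}, g =1 f.
Proof.
move=> f_lin.
by exists (HB.pack_for {linear U -> W} f
  (GRing.isLinear.Build K U W *:%R f f_lin)).
Qed.

Lemma dimension_coordinates (K : numFieldType) (Y : lmodType K) (n : nat) :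
  has_dimension Y n ->
  exists (L : {linear Y -> 'rV[K]_n}) (M : {linear 'rV[K]_n -> Y}),
    cancel L M /\ cancel M L.
Proof.
move=> [e /= e_basis].
pose m (c : 'rV[K]_n) := \sum_(i < n) c ord0 i *: e i.
have m_lin : linear m.
  move=> a c d; rewrite /m scaler_sumr -big_split; apply: eq_bigr => i _.
  by rewrite !mxE scalerDl scalerA.
have m_inj : injective m.
  move=> c d cd; have [c0 [_ uniq]] := e_basis (m c).
  by rewrite -(uniq c erefl) (uniq d cd).
have m_surj x : exists c, m c = x by have [c [xc _]] := e_basis x; exists c.
have [l ml] := choice m_surj.
have l_lin : linear l by move=> a x y; apply: m_inj; rewrite m_lin !ml.
have [[L LE] [M ME]] := (linear_pack l_lin, linear_pack m_lin).
exists L, M; split=> x; rewrite LE ME ?ml //.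
by apply: m_inj; rewrite ml.
Qed.

Section FiniteDimension.
Context {R : realType} {s : scalar_kind}.
Local Notation K := (scalar_field R s).

Lemma l2norm_ge0 n (v : 'rV[K]_n) : 0 <= l2norm v.
Proof. exact: sqrtr_ge0. Qed.

Lemma scalar_abs_le_l2norm n (v : 'rV[K]_n) i :
  scalar_abs (v ord0 i) <= l2norm v.
Proof.
rewrite -[leLHS](ger0_norm (scalar_abs_ge0 _)) -sqrtr_sqr; apply: ler_wsqrtr.
by rewrite (bigD1 i) //= lerDl sumr_ge0 // => j _; exact: sqr_ge0.
Qed.

Lemma l2normZ n (c : K) (v : 'rV[K]_n) :
  l2norm (c *: v) = scalar_abs c * l2norm v.
Proof.
rewrite /l2norm (eq_bigr (fun i =>
  scalar_abs c ^+ 2 * scalar_abs (v ord0 i) ^+ 2)).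
  rewrite -mulr_sumr sqrtrM ?sqr_ge0 // sqrtr_sqr.
  by rewrite (ger0_norm (scalar_abs_ge0 _)).
by move=> i _; rewrite mxE -exprMn -scalar_absM.
Qed.

Lemma l2norm_eq0 n (v : 'rV[K]_n) : l2norm v = 0 -> v = 0.
Proof.
move=> v0; apply/rowP => i; rewrite mxE; apply: scalar_abs_eq0; apply/eqP.
by rewrite eq_le scalar_abs_ge0 andbT -v0 scalar_abs_le_l2norm.
Qed.

(** The bound [A] ensures that the [sup] in [opnorm] is a true supremum. *)
Lemma le_opnorm (U W : Type) (nU : U -> R) (nW : W -> R) (f : U -> W) (A : R) :
  (forall u, nU u <= 1 -> nW (f u) <= A) ->
  forall u, nU u <= 1 -> nW (f u) <= opnorm nU nW f.
Proof.
move=> fA u u1; apply: ub_le_sup; last by exists u.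
by exists A => _ [w w1 <-]; exact: fA.
Qed.

Context {Y : normedModType K}.

(** Transports the norm of [Y] to a definite seminorm on real row vectors, so that the results above
    serve both kinds of scalars. *)
Lemma real_coordinates n (M : {linear 'rV[K]_n -> Y}) (L : Y -> 'rV[K]_n) :
  cancel L M -> cancel M L ->
  exists F : 'rV[R]_(real_dim s n) -> 'rV[K]_n,
    [/\ forall u v, F (u + v) = F u + F v,
        forall t u, F (t *: u) = of_real t *: F u,
        seminorm_rV (fun u => rnorm (M (F u))),
        forall u, rnorm (M (F u)) = 0 -> u = 0 &
        forall x, exists u, M (F u) = x].
Proof.
move=> LK MK; have [F [FD FZ F0 Fsurj]] := @realification R s n.
exists F; split=> //.
- split=> [u v|t u]; first by rewrite FD linearD; exact: rnormD.
  by rewrite FZ linearZ rnormZ scalar_abs_of_real.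
- move=> u /rnorm_eq0 Mu0; apply: F0.
  by rewrite -[F u]MK Mu0 -[0 in LHS](linear0 M) MK.
- by move=> x; have [u Fu] := Fsurj (L x); exists u; rewrite Fu LK.
Qed.

Lemma linear_from_l2_bounded n (M : {linear 'rV[K]_n -> Y}) :
  exists A, forall v, l2norm v <= 1 -> rnorm (M v) <= A.
Proof.
exists (\sum_(i < n) rnorm (M (delta_mx ord0 i))) => v v1.
rewrite [v in rnorm (M v)]row_sum_delta linear_sum.
rewrite (le_trans (rnorm_sum _ _)) //.
apply: ler_sum => i _; rewrite linearZ rnormZ ler_piMl ?rnorm_ge0 //.
exact: le_trans (scalar_abs_le_l2norm _ _) v1.
Qed.

(** In real coordinates the sum of the moduli of the entries is a seminorm, hence dominated by the
    transported norm of [Y]. *)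
Lemma linear_to_l2_bounded n (L : {linear Y -> 'rV[K]_n})
    (M : {linear 'rV[K]_n -> Y}) :
  cancel L M -> cancel M L ->
  exists A, forall x, rnorm x <= 1 -> l2norm (L x) <= A.
Proof.
move=> LK MK; have [F [FD FZ sp p_def Fsurj]] := real_coordinates LK MK.
pose g u := \sum_(i < n) scalar_abs (F u ord0 i).
have sg : seminorm_rV g.
  split=> [u v|t u]; rewrite /g.
    by rewrite -big_split /=; apply: ler_sum => i _; rewrite FD mxE scalar_absD.
  rewrite mulr_sumr; apply: eq_bigr => i _.
  by rewrite FZ mxE scalar_absM scalar_abs_of_real.
have [C C0 gC] := seminorm_dominated sp p_def sg.
exists (Num.sqrt (\sum_(i < n) C ^+ 2)) => x x1; apply: ler_wsqrtr.
apply: ler_sum => i _; rewrite lerXn2r ?nnegrE ?scalar_abs_ge0 ?(ltW C0) //.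
have [u ux] := Fsurj x; rewrite -ux MK.
have le_g : scalar_abs (F u ord0 i) <= g u.
  by rewrite /g (bigD1 i) //= lerDl sumr_ge0 // => j _; exact: scalar_abs_ge0.
rewrite (le_trans le_g) // (le_trans (gC u)) // ux.
by rewrite ger_pMr.
Qed.

(** For a nonzero [v], the norms of [L] and [M] are at least [l2norm v / rnorm (M v)] and its
    inverse, whose product is 1. *)
Lemma banach_mazur_l2_ge1 n : (0 < n)%N -> has_dimension Y n ->
  1 <= banach_mazur_l2 Y n.
Proof.
move=> n0 /dimension_coordinates [L0 [M0 [LK0 MK0]]].
(* An isomorphism must exist, so that the infimum is over a nonempty set. *)
apply: lb_le_inf; first by exists (opnorm (@rnorm R s Y) (@l2norm R s n) L0 *
  opnorm (@l2norm R s n) (@rnorm R s Y) M0), L0, M0.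
move=> _ [L [M [LK MK ->]]].
have [A LA] := linear_to_l2_bounded LK MK.
have [A' MA] := linear_from_l2_bounded M.
pose v : 'rV[K]_n := delta_mx ord0 (Ordinal n0).
have vN0 : v != 0.
  apply/eqP => /rowP /(_ (Ordinal n0)); rewrite !mxE !eqxx.
  by apply/eqP; rewrite oner_eq0.
have Mv0 : 0 < rnorm (M v).
  rewrite lt_neqAle rnorm_ge0 andbT eq_sym.
  apply: contraNneq vN0 => /rnorm_eq0 Mv0.
  by rewrite -[v]MK Mv0 linear0.
have v0 : 0 < l2norm v.
  rewrite lt_neqAle l2norm_ge0 andbT eq_sym.
  by apply: contraNneq vN0 => /l2norm_eq0 ->.
have opL : l2norm v / rnorm (M v) <= opnorm (@rnorm R s Y) (@l2norm R s n) L.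
  have := @le_opnorm _ _ _ _ _ _ LA (of_real (rnorm (M v))^-1 *: M v).
  rewrite linearZ MK l2normZ rnormZ scalar_abs_of_real gtr0_norm ?invr_gt0 //.
  by rewrite mulVf ?gt_eqF // mulrC; apply.
have opM : rnorm (M v) / l2norm v <= opnorm (@l2norm R s n) (@rnorm R s Y) M.
  have := @le_opnorm _ _ _ _ _ _ MA (of_real (l2norm v)^-1 *: v).
  rewrite linearZ l2normZ rnormZ scalar_abs_of_real gtr0_norm ?invr_gt0 //.
  by rewrite mulVf ?gt_eqF // mulrC; apply.
have -> : 1 = l2norm v / rnorm (M v) * (rnorm (M v) / l2norm v).
  by field; rewrite !gt_eqF.
by rewrite ler_pM // divr_ge0 // ltW.
Qed.

Lemma rnorm_compact_seminorm n : has_dimension Y n ->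
  compact_seminorm (@rnorm R s Y).
Proof.
move=> /dimension_coordinates [L [M [LK MK]]].
have [F [FD FZ sp p_def Fsurj]] := real_coordinates LK MK.
split; first by split; [exact: rnorm_ge0|exact: rnormD|exact: rnormZ].
move=> z /bounded_set_rnorm [A A0 zA].
have [w wz] := @choice _ _ (fun k u => M (F u) = z k) (fun k => Fsurj (z k)).
have FB u v : F (u - v) = F u - F v.
  by apply: (addIr (F v)); rewrite -FD !subrK.
have [|phi [phi_inc phi_cauchy]] :=
  bounded_cauchy_subsequence (z := w) (A := A) sp p_def.
  by move=> k; rewrite wz; apply: zA; exists k.
exists phi; split=> //.
apply/cvgrPdist_lt => e e0; have [n0 cauchy] := phi_cauchy e e0.
exists ([set k | (n0 <= k)%N], [set k | (n0 <= k)%N]) => [|[j l] /= [nj nl]].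
  by split=> /=; exists n0.
rewrite sub0r normrN ger0_norm ?rnorm_ge0 // -!wz -linearB -FB.
exact: cauchy.
Qed.

End FiniteDimension.

(** * Covers by sets of small diameter *)

(** A separated family of maximal size is a net, since a point far from all its members could be
    added. *)
Lemma separated_net {R : realType} {N : nat} (p : 'rV[R]_N -> R) (U : Type)
    (f : U -> 'rV[R]_N) (A : set U) (r e : R) :
  seminorm_rV p -> 0 < r -> 0 < e ->
  (forall x y, A x -> A y -> p (f x - f y) <= r) ->
  exists (m : nat) (c : 'I_m -> U),
    [/\ forall i, A (c i),
        forall x, A x -> exists i, p (f x - f (c i)) <= e &
        m%:R <= (1 + 2 * r / e) ^+ N].
Proof.
move=> sp r0 e0 Ar.
pose sep m (c : 'I_m -> U) := (forall i, A (c i)) /\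
  (forall i j, i != j -> e < p (f (c i) - f (c j))).
have sep_bound m (c : 'I_m -> U) : sep m c -> m%:R <= (1 + 2 * r / e) ^+ N.
  case: m c => [|m] c [Ac csep].
    by rewrite exprn_ge0 // addr_ge0 // divr_ge0 ?mulr_ge0 // ltW.
  (* Translating by one member puts the family in the ball of radius [r] about 0; the empty family
     has no such member. *)
  apply: (packing_bound (x := fun i => f (c i) - f (c ord0)) sp r0 e0).
    by move=> i; exact: Ar.
  by move=> i j ij; rewrite opprB addrA subrK csep.
have ex_sep : exists m, `[< exists c, sep m c >].
  exists 0%N; apply/asboolP.
  exists (fun i : 'I_0 => False_rect U (notF (ltn_ord i))).
  by split=> -[].
have ub_sep m : `[< exists c, sep m c >] ->
    (m <= Num.truncn ((1 + 2 * r / e) ^+ N))%N.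
  move=> /asboolP [c /sep_bound mle].
  by rewrite truncn_ge_nat // (le_trans _ mle).
have [m /asboolP [c csep] m_max] := ex_maxnP ex_sep ub_sep.
exists m, c; split; [exact: csep.1 | | exact: sep_bound csep].
move=> x Ax; apply: contrapT => /forallNP far.
have {}far i : e < p (f x - f (c i)) by rewrite ltNge; exact/negP.
have [Ac cc] := csep.
suff /m_max : `[< exists c, sep m.+1 c >] by rewrite ltnn.
apply/asboolP.
exists (fun i => if unlift ord0 i is Some j then c j else x); split=> [i|i j].
  by case: unliftP.
case: (unliftP ord0 i) => [i' ->|->]; case: (unliftP ord0 j) => [j' ->|->].
- by rewrite (inj_eq lift_inj) => /cc.
- by move=> _; rewrite (seminormB sp).
- by [].
- by rewrite eqxx.
Qed.

Section Dynamics.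
Context {R : realType} {s : scalar_kind}.
Context {X : normedModType (scalar_field R s)} {V : set X}.

(** Nonempty pieces inside [G] provide the centres in [G] that [covering_number] demands. *)
Definition diam_cover (G : set V) (d b : R) : Prop :=
  exists (I : finType) (D : I -> set V),
    [/\ forall i, D i !=set0 /\ D i `<=` G,
        G `<=` \bigcup_i D i,
        forall i x y, D i x -> D i y -> vdist x y <= d &
        #|I|%:R <= b].

Lemma diam_cover_covering_number (G : set V) (d b eps : R) :
  diam_cover G d b -> d < eps -> (covering_number G eps <= b%:E)%E.
Proof.
move=> [I [D [DG GD Dd Ib]]] d_eps.
have [c Dc] := choice (fun i => (DG i).1).
apply: ge_ereal_inf; exists (#|I|%:R)%:E; last by rewrite lee_fin.
exists #|I| => //; exists (fun i => c (enum_val i)); split=> [i|x /GD [i _ Dx]].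
  by apply: (DG _).2; exact: Dc.
exists (enum_rank i) => //=; rewrite enum_rankK.
by apply: le_lt_trans d_eps; apply: (Dd i) => //; exact: Dc.
Qed.

(* Each piece is split according to a net for its image in the
   finite-dimensional space; the squeezing inequality then contracts the
   diameters of the images of the parts by the factor eta + sigma. *)
Lemma diam_cover_image (N : nat) (p : 'rV[R]_N -> R) (F : V -> V)
    (f : V -> 'rV[R]_N) (G : set V) (d b eta mu kappa sigma : R) :
  seminorm_rV p -> 0 <= eta -> 0 < mu -> 0 < kappa -> 0 < sigma -> 0 < d ->
  (forall x y, G x -> G y ->
     vdist (F x) (F y) <= eta * vdist x y + mu * p (f x - f y) /\
     p (f x - f y) <= kappa * vdist x y) ->
  diam_cover G d b ->
  diam_cover (F @` G) ((eta + sigma) * d)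
    (b * (1 + 4 * kappa * mu / sigma) ^+ N).
Proof.
move=> sp eta0 mu0 kappa0 sigma0 d0 squeeze [I [D [DG GD Dd Ib]]].
have r0 : 0 < kappa * d by rewrite mulr_gt0.
(* Points this close to a common centre differ by at most [sigma * d / mu], which contributes
   [sigma * d] after multiplication by [mu]. *)
have e0 : 0 < sigma * d / (2 * mu) by rewrite divr_gt0 ?mulr_gt0.
have net i : exists mc : {m : nat & 'I_m -> V},
    [/\ forall j, D i (tagged mc j),
        forall x, D i x ->
          exists j, p (f x - f (tagged mc j)) <= sigma * d / (2 * mu) &
        (tag mc)%:R <= (1 + 4 * kappa * mu / sigma) ^+ N].
  have [|m [c [Dc net mle]]] := @separated_net _ _ _ _ f (D i) _ _ sp r0 e0.
    move=> x y Dx Dy; apply: (le_trans (squeeze _ _ _ _).2);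
      [exact: (DG i).2 | exact: (DG i).2 |].
    by rewrite ler_pM2l // (Dd i).
  exists (Tagged (fun m => 'I_m -> V) c); split=> //=.
  (* [d] cancels, so every iteration multiplies the number of pieces by at most the same factor. *)
  suff <- : 1 + 2 * (kappa * d) / (sigma * d / (2 * mu)) =
      1 + 4 * kappa * mu / sigma by [].
  by field; rewrite !gt_eqF.
have [mc mcP] := choice net.
(* A new piece is an old piece together with a point of its own net. *)
pose J : finType := {i : I & 'I_(tag (mc i))}.
pose ctr (j : J) : V := tagged (mc (tag j)) (tagged j).
have Dctr j : D (tag j) (ctr j) by have [Dc _ _] := mcP (tag j); exact: Dc.
exists J, (fun j : J => F @` [set x | D (tag j) x /\
  p (f x - f (ctr j)) <= sigma * d / (2 * mu)]).
split.
- move=> j; split.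
    exists (F (ctr j)), (ctr j) => //; split; first exact: Dctr.
    by rewrite subrr (seminorm0 sp) ltW.
  by move=> _ [x [Dx _] <-]; exists x => //; exact: (DG _).2 Dx.
- move=> _ [x Gx <-]; have [i _ Dx] := GD _ Gx.
  have [_ /(_ _ Dx) [j xj] _] := mcP i.
  by exists (Tagged (fun i => 'I_(tag (mc i))) j) => //; exists x.
- move=> j _ _ [x [Dx xj] <-] [y [Dy yj] <-].
  apply: (le_trans (squeeze _ _ ((DG _).2 _ Dx) ((DG _).2 _ Dy)).1).
  rewrite mulrDl lerD //; first by rewrite ler_wpM2l // (Dd (tag j)).
  have -> : sigma * d = mu * (sigma * d / (2 * mu) + sigma * d / (2 * mu)).
    by field; rewrite gt_eqF.
  rewrite ler_pM2l // -[f x](subrK (f (ctr j))) -addrA.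
  by rewrite (le_trans (sp.1 _ _)) // lerD // (seminormB sp).
- rewrite card_tagged sumnE big_map big_enum /= natr_sum.
  apply: (@le_trans _ _ (\sum_(i : I) (1 + 4 * kappa * mu / sigma) ^+ N)).
    by apply: ler_sum => i _; rewrite card_ord; have [] := mcP i.
  rewrite sumr_const -[leLHS]mulr_natl ler_wpM2r // exprn_ge0 // addr_ge0 //.
  by rewrite divr_ge0 ?mulr_ge0 // ltW.
Qed.

End Dynamics.

(** * Quasi-stability and the exponential covering estimate *)

Theorem proposition6p3 (R : realType) (s : scalar_kind)
    (X : normedModType (scalar_field R s)) (V : set X) (V_neq0 : V !=set0)
    (tau : time_kind) (S : R -> V -> V) (S_semigroup : is_semigroup tau S)
    (B : set V) (T : R) (T_time : time_set tau T) (T_gt0 : 0 < T)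
    (n : nat) (Xn : normedModType (scalar_field R s)) (P : V -> Xn)
    (eta mu kappa : R)
    (squeezing : generalized_squeezing S B T n P eta mu kappa) :
  quasi_stable S B T (@rnorm R s Xn) eta (kappa * mu) /\
  (forall sigma : R,
     B !=set0 -> bounded_set (\val @` B) -> S T @` B `<=` B ->
     0 < sigma < 1 - eta ->
     exists (k0 : nat) (a b h : R),
       [/\ (0 < k0)%N, 0 < a /\ 0 < b, 1 <= h,
           h <= (1 + 4 * kappa * mu * banach_mazur_l2 Xn n / sigma)
                  ^+ real_dim s n &
           forall k : nat, (k0 <= k)%N ->
             (covering_number (S (k%:R * T)%R @` B) (a * (eta + sigma) ^+ k)%R
                <= (b * h ^+ k)%R%:E)%E]).
Proof.
have [[n_gt0 Xn_dim] eta_bnd mu0 kappa0 squeeze] := squeezing.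
have [eta0 eta1] := andP eta_bnd.
split.
  split=> //; [exact: rnorm_compact_seminorm Xn_dim | exact: mulr_gt0 |].
  exists (fun x => of_real mu *: P (S T (\val x))) => x y.
  have [] := squeeze (\val x) (\val y) (set_valP x) (set_valP y).
  rewrite -scalerBr rnormZ scalar_abs_of_real gtr0_norm // => h1 h2.
  by rewrite mulrC [kappa * mu]mulrC -mulrA mulrC ler_pM2l.
move=> sigma [x0 Bx0] /bounded_set_rnorm [A A0 BA] SB /andP[sigma0 _].
have [L [M [LK MK]]] := dimension_coordinates Xn_dim.
have [F [FD FZ sp p_def Fsurj]] := real_coordinates LK MK.
(* [f x] consists of real coordinates of [P (S T x)]. *)
have [f fP] := choice (fun x => Fsurj (P (S T x))).
have FB u v : M (F (u - v)) = M (F u) - M (F v).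
  by rewrite -linearB; congr (M _); apply: (addIr (F v)); rewrite -FD !subrK.
pose h := (1 + 4 * kappa * mu / sigma) ^+ real_dim s n.
have q0 : 0 < eta + sigma by rewrite ltr_wpDl.
have h_ge1 : 1 <= h.
  by rewrite exprn_ege1 // lerDl divr_ge0 ?mulr_ge0 // ltW.
have kT_time (k : nat) : time_set tau (k%:R * T).
  move: T_time; rewrite /time_set; case: (tau) => /= [T0 | [m _ <-]].
    by rewrite mulr_ge0.
  by exists (k * m)%N => //; rewrite natrM.
have SkS (k : nat) : S (k.+1%:R * T) @` B = S T @` (S (k%:R * T) @` B).
  rewrite image_comp; apply: eq_imagel => x _ /=.
  by rewrite S_semigroup.2 // -[k.+1]addn1 addnC natrD mulrDl mul1r.
have SkB (k : nat) : S (k%:R * T) @` B `<=` B.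
  elim: k => [|k IH]; first by move=> _ [x Bx <-]; rewrite mul0r S_semigroup.1.
  rewrite SkS; apply: subset_trans SB; exact: image_subset.
(* Induction from the single piece [B], of diameter at most [2 * A]; by [SkB] all iterates stay
   where the squeezing inequalities hold. *)
have cover (k : nat) :
    diam_cover (S (k%:R * T) @` B) (2 * A * (eta + sigma) ^+ k) (h ^+ k).
  elim: k => [|k IH].
    exists unit, (fun=> S (0%:R * T) @` B); split.
    - by move=> _; split=> //; exists (S (0%:R * T) x0), x0.
    - by move=> x Sx; exists tt.
    - move=> _ x y /SkB Bx /SkB By; rewrite expr0 mulr1 /vdist.
      rewrite (le_trans (rnormD _ _)) // -[- _]sub0r rnormB subr0.
      by rewrite mulr_natl mulr2n lerD // BA.
    - by rewrite card_unit expr0.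
  rewrite SkS exprS mulrCA exprSr.
  apply: (@diam_cover_image _ _ _ _ _ _ _ f _ _ _ _ mu) sp _ _ _ _ _ _ IH => //.
    by rewrite !mulr_gt0 // exprn_gt0.
  move=> x y /SkB Bx /SkB By; rewrite /= FB !fP; exact: squeeze.
(* Doubling [2 * A] gives the strict inequality needed for open balls. *)
exists 1%N, (4 * A), 1, h; split=> //.
- by rewrite mulr_gt0.
- apply: lerXn2r; rewrite ?nnegrE.
  + by rewrite addr_ge0 // divr_ge0 ?mulr_ge0 // ltW.
  + rewrite addr_ge0 // divr_ge0 ?mulr_ge0 ?(ltW kappa0) ?(ltW mu0)
      ?(ltW sigma0) //.
    by rewrite (le_trans ler01) // banach_mazur_l2_ge1.
  rewrite lerD2l ler_pM2r ?invr_gt0 // ler_peMr ?banach_mazur_l2_ge1 //.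
  by rewrite !mulr_ge0 // ltW.
move=> k _; rewrite mul1r; apply: diam_cover_covering_number (cover k) _.
rewrite ltr_pM2r ?exprn_gt0 // ltr_pM2r //.
by rewrite ltr_nat.
Qed.
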